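(* Let $p\geq 2$ and let $h\in C^2(\mathbb{R}^n)$ be nonnegative, positively homogeneous of degree $p$, and such that there are constants $0<\lambda\le\Lambda$ with $$\lambda |v|^2\leq \langle D^2h(x)v,v\rangle\leq \Lambda |v|^2\qquad\text{for all } x\in S^{n-1},\ v\in\mathbb{R}^n.$$ Let $T$ be an $h$-monotone map with $T\in L^{p-1}_{\mathrm{loc}}(\mathbb{R}^n)$, let $A\in\mathbb{R}^{n\times n}$, $b\in\mathbb{R}^n$, $0<\beta<1$, and set $u(x)=Tx-Ax-b$. Then there are constants $C(n,p,\beta)>0$, $K_1>0$ depending only on $n,p,\lambda,\Lambda,\|A\|$, and $K_2>0$ depending only on $n,p,\lambda,\Lambda,\|A\|,\beta$, such that for each $x_0\in\mathbb{R}^n$ and $R>0$: $$\sup_{x\in B_{\beta R}(x_0)}|u(x)|\leq \begin{cases} K_1\,R\left(R^{-(p-1)}\fint_{B_R(x_0)}|u(x)|^{p-1}dx\right)^{1/(n+p-1)} & \text{if } \left(\fint_{B_R(x_0)}|u|^{p-1}dx\right)^{1/(p-1)}\leq C(n,p,\beta)R,\\[2mm] K_2\,R\left(R^{-(p-1)}\fint_{B_R(x_0)}|u(x)|^{p-1}dx\right)^{1/(p-1)} & \text{if } \left(\fint_{B_R(x_0)}|u|^{p-1}dx\right)^{1/(p-1)}\geq C(n,p,\beta)R.\end{cases}$$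
   Context: A multivalued map $T:\mathbb{R}^n\to\mathcal P(\mathbb{R}^n)$ is called $h$-monotone if $h(x-\xi)+h(y-\zeta)\leq h(x-\zeta)+h(y-\xi)$ for all $x,y\in\mathrm{dom}(T)=\{x: T(x)\neq\emptyset\}$ and all $\xi\in T(x)$, $\zeta\in T(y)$. For the costs $h$ considered, such maps are single-valued almost everywhere, so $T$ is regarded as an a.e. defined function $\mathbb{R}^n\to\mathbb{R}^n$, and $T\in L^{p-1}_{\mathrm{loc}}$ refers to this function. $\fint_B$ denotes the average over $B$, $B_r(x)$ the open ball of radius $r$ centered at $x$, $\|A\|$ the operator norm, and the supremum is understood as an essential supremum. *)

(* Defs.v *)
From HB Require Import structures.
From mathcomp Require Import all_boot all_order all_algebra.
From mathcomp Require Import all_classical all_reals all_analysis.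
Set Implicit Arguments. Unset Strict Implicit. Unset Printing Implicit Defensive.
Import Order.TTheory GRing.Theory Num.Theory.
Import numFieldNormedType.Exports.
Local Open Scope classical_set_scope.
Local Open Scope ring_scope.

Section defs.
Variable R : realType.

Definition enorm n (v : 'cV[R]_n) : R := Num.sqrt (\sum_i v i 0 ^+ 2).

Definition eball n (x0 : 'cV[R]_n) (r : R) : set 'cV[R]_n :=
  [set x | enorm (x - x0) < r].

Definition opnorm n (A : 'M[R]_n) : R :=
  sup [set enorm (A *m v) | v in [set v : 'cV[R]_n | enorm v <= 1]].

Definition ecoord n (i : 'I_n) : 'cV[R]_n := delta_mx i 0.

Definition partial n (i : 'I_n) (f : 'cV[R]_n -> R) : 'cV[R]_n -> R :=
  fun x => 'D_(ecoord i) f x.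

Definition C2 n (f : 'cV[R]_n -> R) : Prop :=
  (forall x i, derivable f x (ecoord i)) /\
  (forall x i j, derivable (partial i f) x (ecoord j)) /\
  (forall i j, continuous (partial j (partial i f))).

Definition hessian n (f : 'cV[R]_n -> R) (x : 'cV[R]_n) : 'M[R]_n :=
  \matrix_(i, j) partial j (partial i f) x.

Fixpoint lebint (n : nat) : ('cV[R]_n -> \bar R) -> \bar R :=
  match n with
  | 0 => fun f => f 0
  | m.+1 => fun f => (\int[@lebesgue_measure R]_x
             lebint (fun y : 'cV[R]_m => f (col_mx (const_mx x : 'cV[R]_1) y)))%E
  end.


Definition lebvol n (S : set 'cV[R]_n) : \bar R := lebint (fun x => (\1_S x)%:E).

Definition setint n (S : set 'cV[R]_n) (f : 'cV[R]_n -> \bar R) : \bar R :=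
  lebint (fun x => ((\1_S x)%:E * f x)%E).

Definition borel n : set (set 'cV[R]_n) := <<s [set O | open O] >>.

Definition borel_measurable n m (f : 'cV[R]_n -> 'cV[R]_m) : Prop :=
  forall O : set 'cV[R]_m, open O -> borel (f @^-1` O).

Definition lebnull n (S : set 'cV[R]_n) : Prop :=
  exists N, borel N /\ S `<=` N /\ lebvol N = 0%E.

(* f in L^q_loc(R^n) (Borel representative) *)
Definition Lloc n (q : R) (f : 'cV[R]_n -> 'cV[R]_n) : Prop :=
  borel_measurable f /\
  forall K : set 'cV[R]_n, compact K ->
    (setint K (fun x => (enorm (f x) `^ q)%:E) < +oo)%E.

Definition average n (S : set 'cV[R]_n) (g : 'cV[R]_n -> R) : R :=
  fine (setint S (fun x => (g x)%:E)) / fine (lebvol S).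

Definition esssup n (S : set 'cV[R]_n) (g : 'cV[R]_n -> R) : \bar R :=
  ereal_inf [set M : \bar R | lebnull [set x | S x /\ (M < (g x)%:E)%E]].

Definition h_monotone n (h : 'cV[R]_n -> R) (T : 'cV[R]_n -> set 'cV[R]_n) : Prop :=
  forall x y xi zeta, T x xi -> T y zeta ->
    h (x - xi) + h (y - zeta) <= h (x - zeta) + h (y - xi).

End defs.

(* Main.v *)
Require Import Defs.
From HB Require Import structures.
From mathcomp Require Import all_boot all_order all_algebra.
From mathcomp Require Import all_classical all_reals all_analysis measurable_realfun.
From mathcomp Require Import ring lra.
Import Order.TTheory GRing.Theory Num.Theory.
Import numFieldNormedType.Exports.
Local Open Scope classical_set_scope.
Local Open Scope ring_scope.

(* Write [T x = A x + b + u x].  The h-monotonicity says that the mixed second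
   difference of [h] along [y - x] and [T x - T y] is nonpositive, so by
   the mean value theorem [<D^2h(z)(T y - T x), y - x> >= 0] at some [z <> 0].
   Choose [y] within [lam / (2 Lam) * del] of [x + del * u x / |u x|]: ellipticity
   makes [<D^2h(z) (u x), y - x>] comparable to [|z|^(p-2) del |u x|], whatever [z]
   is, and the factor [|z|^(p-2)] cancels, leaving
     [lam / (4 Lam) * |u x| <= |u y| + 2 |A| del]
   for almost every such [y].  Averaging the power [p - 1] over these [y] bounds
   [|u x|] by [(r / del)^(n / (p-1))] times the L^(p-1) mean of [|u|], plus a
   multiple of [del].  The two cases are the optimal [del], when it fits inside the ball, and
   the largest admissible [del] otherwise. *)

(** * Bilinear forms, the Euclidean norm and the operator norm *)

(** The order of the factors is that of the ellipticity hypothesis on [hessian h], so the hypothesis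
    applies by conversion. *)
Definition mxform {R : realType} {n : nat} (H : 'M[R]_n) (v w : 'cV[R]_n) : R :=
  \sum_i \sum_j H i j * v i 0 * w j 0.

Section bilinear_forms.
Context {R : realType} {n : nat}.
Implicit Types (H : 'M[R]_n) (u v w : 'cV[R]_n).

Lemma mxformDl H u v w : mxform H (u + v) w = mxform H u w + mxform H v w.
Proof.
rewrite /mxform -big_split; apply: eq_bigr => i _.
rewrite -big_split; apply: eq_bigr => j _; rewrite !mxE /=; ring.
Qed.

Lemma mxformDr H u v w : mxform H w (u + v) = mxform H w u + mxform H w v.
Proof.
rewrite /mxform -big_split; apply: eq_bigr => i _.
rewrite -big_split; apply: eq_bigr => j _; rewrite !mxE /=; ring.
Qed.

Lemma mxformZl H (k : R) v w : mxform H (k *: v) w = k * mxform H v w.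
Proof.
rewrite /mxform mulr_sumr; apply: eq_bigr => i _.
rewrite mulr_sumr; apply: eq_bigr => j _; rewrite !mxE /=; ring.
Qed.

Lemma mxformZr H (k : R) v w : mxform H v (k *: w) = k * mxform H v w.
Proof.
rewrite /mxform mulr_sumr; apply: eq_bigr => i _.
rewrite mulr_sumr; apply: eq_bigr => j _; rewrite !mxE /=; ring.
Qed.

Lemma mxform_sym H v w : (forall i j, H i j = H j i) ->
  mxform H v w = mxform H w v.
Proof.
move=> Hs; rewrite /mxform exchange_big /=; apply: eq_bigr => i _.
apply: eq_bigr => j _; rewrite (Hs j i); ring.
Qed.

Lemma enorm_ge0 v : 0 <= enorm v.
Proof. exact: sqrtr_ge0. Qed.

Lemma sqr_enorm v : enorm v ^+ 2 = \sum_i v i 0 ^+ 2.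
Proof. by rewrite sqr_sqrtr // sumr_ge0 // => i _; rewrite sqr_ge0. Qed.

Lemma enormZ (k : R) v : enorm (k *: v) = `|k| * enorm v.
Proof.
rewrite /enorm -sqrtr_sqr -sqrtrM ?sqr_ge0 // mulr_sumr; congr (Num.sqrt _).
by apply: eq_bigr => i _; rewrite mxE exprMn.
Qed.

Lemma enormN v : enorm (- v) = enorm v.
Proof. by rewrite -scaleN1r enormZ normrN1 mul1r. Qed.

Lemma enorm0 : enorm (0 : 'cV[R]_n) = 0.
Proof. by rewrite -(scale0r 0) enormZ normr0 mul0r. Qed.

Lemma enorm_eq0 v : (enorm v == 0) = (v == 0).
Proof.
apply/eqP/eqP => [v0|->]; last exact: enorm0.
have : \sum_i v i 0 ^+ 2 == 0 by rewrite -sqr_enorm v0 expr0n.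
rewrite psumr_eq0 => [/allP vi|i _]; last exact: sqr_ge0.
apply/colP => i; rewrite mxE; apply/eqP.
by have := vi i (mem_index_enum i); rewrite sqrf_eq0.
Qed.

Lemma enorm_gt0 v : (0 < enorm v) = (v != 0).
Proof. by rewrite lt0r enorm_ge0 andbT enorm_eq0. Qed.

Lemma mxform1 v : mxform 1%:M v v = enorm v ^+ 2.
Proof.
rewrite sqr_enorm; apply: eq_bigr => i _.
rewrite (bigD1 i) //= big1 => [|j /negbTE ji]; first by rewrite mxE eqxx mulr1n; ring.
by rewrite mxE eq_sym ji mulr0n !mul0r.
Qed.

(* AM-GM for the unit vectors: [0 <= H(v' +- w', v' +- w')] bounds [H(v', w')]
   by the mean of [H(v', v')] and [H(w', w')]. *)
Lemma mxform_bound H (L : R) v w : (forall i j, H i j = H j i) ->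
  (forall z, 0 <= mxform H z z <= L * enorm z ^+ 2) ->
  `|mxform H v w| <= L * enorm v * enorm w.
Proof.
move=> Hs HL.
have [->|v0] := eqVneq v 0.
  by rewrite enorm0 -(scale0r 0) mxformZl mul0r normr0 mulr0 mul0r.
have [->|w0] := eqVneq w 0.
  by rewrite enorm0 -(scale0r 0) mxformZr mul0r normr0 mulr0.
have nv : 0 < enorm v by rewrite enorm_gt0.
have nw : 0 < enorm w by rewrite enorm_gt0.
pose e := (enorm v)^-1 *: v; pose f := (enorm w)^-1 *: w.
have e1 : enorm e = 1 by rewrite enormZ gtr0_norm ?invr_gt0 // mulVf ?gt_eqF.
have f1 : enorm f = 1 by rewrite enormZ gtr0_norm ?invr_gt0 // mulVf ?gt_eqF.
have -> : mxform H v w = enorm v * enorm w * mxform H e f.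
  by rewrite /e /f mxformZl mxformZr; field; rewrite !gt_eqF.
rewrite !normrM (gtr0_norm nv) (gtr0_norm nw) mulrC -mulrA.
rewrite ler_wpM2r ?mulr_ge0 ?enorm_ge0 //.
clearbody e f; have /andP[_ He] := HL e; have /andP[_ Hf] := HL f.
have /andP[Hp _] := HL (e + f); have /andP[Hm _] := HL (e + -1 *: f).
move: Hp Hm He Hf; rewrite e1 f1 !mxformDl !mxformDr !mxformZl !mxformZr.
rewrite (mxform_sym _ f e Hs) => Hp Hm He Hf.
by rewrite ler_norml; apply/andP; split; lra.
Qed.

(** Cauchy-Schwarz is [mxform_bound] for the identity matrix with [L = 1]; the triangle inequality
    follows by expanding the square. *)
Lemma ler_enormD v w : enorm (v + w) <= enorm v + enorm w.
Proof.
have CS : mxform 1%:M v w <= enorm v * enorm w.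
  rewrite (le_trans (ler_norm _)) // -(mul1r (enorm v)).
  apply: mxform_bound => [i j|z]; first by rewrite !mxE eq_sym.
  by rewrite mxform1 mul1r sqr_ge0 lexx.
have := mxform1 (v + w); rewrite !mxformDl !mxformDr !mxform1.
rewrite (@mxform_sym 1%:M w v) => [E|i j]; last by rewrite !mxE eq_sym.
rewrite -(@ler_pXn2r _ 2) ?nnegrE ?addr_ge0 ?enorm_ge0 // -E sqrrD; lra.
Qed.

Lemma coord_le_enorm v i : `|v i 0| <= enorm v.
Proof.
rewrite -sqrtr_sqr ler_sqrt; last by rewrite sumr_ge0 // => j _; exact: sqr_ge0.
by rewrite (bigD1 i) //= lerDl sumr_ge0 // => j _; exact: sqr_ge0.
Qed.

Lemma enorm_le_sum v : enorm v <= \sum_i `|v i 0|.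
Proof.
rewrite -(@ler_pXn2r _ 2) ?nnegrE ?enorm_ge0 ?sumr_ge0 // sqr_enorm expr2.
rewrite mulr_suml; apply: ler_sum => i _.
rewrite -normr_id -real_normK ?num_real // expr2 normr_id ler_wpM2l //.
by rewrite (bigD1 i) //= lerDl sumr_ge0.
Qed.

Lemma enorm_mulmx_le (A : 'M[R]_n) v : enorm (A *m v) <= opnorm A * enorm v.
Proof.
have [->|v0] := eqVneq v 0; first by rewrite mulmx0 enorm0 mulr0.
have nv : 0 < enorm v by rewrite enorm_gt0.
(* Without an upper bound [sup] would be a default value; the sum of the absolute entries of [A] is
   such a bound. *)
have ub : has_ubound [set enorm (A *m v) | v in [set v : 'cV[R]_n | enorm v <= 1]].
  exists (\sum_i \sum_j `|A i j|) => _ [w /= w1 <-].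
  apply: (le_trans (enorm_le_sum _)); apply: ler_sum => i _.
  rewrite mxE (le_trans (ler_norm_sum _ _ _)) //; apply: ler_sum => j _.
  by rewrite normrM ler_piMr // (le_trans (coord_le_enorm _ _)).
have : enorm (A *m ((enorm v)^-1 *: v)) <= opnorm A.
  apply: ub_le_sup => //; exists ((enorm v)^-1 *: v) => //=.
  by rewrite enormZ gtr0_norm ?invr_gt0 // mulVf ?gt_eqF.
rewrite -scalemxAr enormZ gtr0_norm ?invr_gt0 //.
by rewrite mulrC ler_pdivrMr.
Qed.

Lemma opnorm_ge0 (A : 'M[R]_n) : 0 <= opnorm A.
Proof.
have [[v v0]|nov] := pselect (exists v : 'cV[R]_n, v != 0).
  have := le_trans (enorm_ge0 _) (enorm_mulmx_le A v).
  by rewrite pmulr_lge0 // enorm_gt0.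
(* Only the zero vector exists here ([n = 0]), so the supremum is over the set containing 0
   alone. *)
rewrite /opnorm (_ : [set _ | _ in _] = [set 0]) ?sup1 //.
apply/seteqP; split => [_ [v _ <-] /=|_ ->].
  apply/eqP; rewrite enorm_eq0; apply/eqP; apply: contrapT => /eqP Av.
  by apply: nov; exists (A *m v).
by exists 0; rewrite /= ?mulmx0 enorm0 ?ler01.
Qed.

End bilinear_forms.

(** * Mean value theorems, and directional derivatives from continuous partials *)

Section directional_derivatives.
Context {R : realType} {n : nat}.
Implicit Types (f h : 'cV[R]_n -> R) (x v a b z : 'cV[R]_n).

Lemma is_derive_line f x v (s d : R) : is_derive (x + s *: v) v f d ->
  is_derive s 1 (fun t : R => f (x + t *: v)) d.
Proof.
have E : (fun k : R => k^-1 *: ((fun t : R => f (x + t *: v)) (k *: 1 + s) -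
    f (x + s *: v))) = (fun k : R => k^-1 *: (f (k *: v + (x + s *: v)) - f (x + s *: v))).
  apply/funext => k; congr (_ *: (f _ - _)).
  by rewrite [k *: 1]mulr1 scalerDl addrCA.
case=> df <-; split; first by rewrite /derivable E.
by rewrite /derive E.
Qed.

Lemma is_derive_partial f x (i : 'I_n) : derivable f x (ecoord R i) ->
  is_derive x (ecoord R i) f (partial i f x).
Proof. by move=> df; split. Qed.

Lemma MVT_line f (g : 'cV[R]_n -> R) x v :
  (forall z, is_derive z v f (g z)) ->
  forall s t : R, s < t -> exists2 c : R, s < c < t &
    f (x + t *: v) - f (x + s *: v) = g (x + c *: v) * (t - s).
Proof.
move=> fg s t st.
have dphi (c : R) : is_derive c (1 : R) (fun r : R => f (x + r *: v)) (g (x + c *: v)).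
  exact: is_derive_line.
have [c] := @MVT R (fun r : R => f (x + r *: v)) (fun c => g (x + c *: v)) s t
  st (fun c _ => dphi c)
  (derivable_within_continuous (fun c _ => @ex_derive _ _ _ _ _ _ _ (dphi c))).
by rewrite in_itv /= => cst E; exists c.
Qed.


(** The coordinate increments to which this is applied may have any sign or vanish, so the
    intermediate parameter is only located by [|c| <= |s|]. *)
Lemma MVT_line_norm f (g : 'cV[R]_n -> R) x v :
  (forall z, is_derive z v f (g z)) ->
  forall s : R, exists2 c : R, `|c| <= `|s| &
    f (x + s *: v) - f x = g (x + c *: v) * s.
Proof.
move=> fg s; have [s0|s0|->] := ltgtP s 0.
- have [c /andP[sc c0] E] := MVT_line f g x v fg _ _ s0.
  exists c; first by rewrite !ltr0_norm // lerN2 ltW.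
  by rewrite -(opprB (f x)); move: E; rewrite scale0r addr0 => ->; ring.
- have [c /andP[c0 cs] E] := MVT_line f g x v fg _ _ s0.
  exists c; first by rewrite !gtr0_norm // ltW.
  by move: E; rewrite scale0r addr0 subr0.
- by exists 0 => //; rewrite scale0r addr0 subrr mulr0.
Qed.

(** The corners [x + trunc_col k v] form a staircase from [x] to [x + v] whose edges are parallel to
    the axes. *)
Definition trunc_col k v : 'cV[R]_n := \col_i (if (i < k)%N then v i 0 else 0).

Lemma trunc_colS (i : 'I_n) v :
  trunc_col i.+1 v = trunc_col i v + v i 0 *: ecoord R i.
Proof.
apply/colP => j; rewrite !mxE eqxx andbT.
have [->|ji] := eqVneq j i; first by rewrite ltnS leqnn ltnn mulr1 add0r.
by rewrite mulr0 addr0 ltnS leq_eqVlt (negbTE (ji : (j != i :> nat))).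
Qed.

Lemma coord_le_norm v (i : 'I_n) : `|v i 0| <= `|v|.
Proof.
rewrite [leRHS]/Num.Def.normr/= mx_normrE.
exact: (le_bigmax _ (fun ij : 'I_n * 'I_1 => `|v ij.1 ij.2|) (i, 0)).
Qed.

Lemma norm_le v (r : R) : 0 <= r -> (forall i, `|v i 0| <= r) -> `|v| <= r.
Proof.
move=> r0 vr; rewrite [leLHS]/Num.Def.normr/= mx_normrE.
by apply: bigmax_le => // -[i j] _ /=; rewrite ord1.
Qed.

(* Moving from [x] to [x + v] one coordinate at a time. *)
Lemma coordinate_MVT f x v : (forall y i, derivable f y (ecoord R i)) ->
  exists2 xi : 'I_n -> 'cV[R]_n, (forall i, `|xi i - x| <= `|v|) &
    f (x + v) - f x = \sum_i partial i f (xi i) * v i 0.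
Proof.
move=> df.
have step (i : 'I_n) : exists y : 'cV[R]_n, `|y - x| <= `|v| /\
    f (x + trunc_col i.+1 v) - f (x + trunc_col i v) = partial i f y * v i 0.
  have [c cv E] := MVT_line_norm f (partial i f) (x + trunc_col i v) (ecoord R i)
    (fun z => is_derive_partial f z i (df z i)) (v i 0).
  exists (x + trunc_col i v + c *: ecoord R i); split; last first.
    by rewrite trunc_colS addrA.
  rewrite -[x + _ + _]addrA (addrC x) addrK; apply: norm_le => // j.
  rewrite !mxE eqxx andbT.
  have [->|_] := eqVneq j i; first by rewrite ltnn add0r mulr1 (le_trans cv) // coord_le_norm.
  rewrite mulr0 addr0; case: ifP => _; last by rewrite normr0.
  exact: coord_le_norm.
exists (fun i => sval (cid (step i))) => [i|].
  by have [] := svalP (cid (step i)).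
transitivity (\sum_(0 <= k < n) (f (x + trunc_col k.+1 v) - f (x + trunc_col k v))).
  rewrite telescope_sumr //; congr (f (x + _) - f _).
    by apply/colP => i; rewrite mxE ltn_ord.
  by rewrite (_ : trunc_col 0 v = 0) ?addr0 //; apply/colP => i; rewrite !mxE.
rewrite big_mkord; apply: eq_bigr => i _.
by have [] := svalP (cid (step i)).
Qed.

Lemma partials_near f x (e : R) : (forall i, continuous (partial i f)) -> 0 < e ->
  exists2 d : R, 0 < d &
    forall z, `|z - x| < d -> forall i, `|partial i f x - partial i f z| <= e.
Proof.
move=> cf e0.
have /nbhs_ballP[d /= d0 near_d] :
    nbhs x [set z | forall i, `|partial i f x - partial i f z| <= e].
  apply: (@filter_forall _ _ (fun i z => `|partial i f x - partial i f z| <= e)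
    (nbhs x) (nbhs_filter x)) => i.
  by have /cvgrPdist_le := cf i x; exact.
exists d => // z zd; apply: near_d.
by rewrite -ball_normE /= distrC.
Qed.

(** By [coordinate_MVT] the difference quotient along [v] is a combination of partials taken within
    [|t v|] of [x], and these tend to the partials at [x]. *)
Lemma C1_is_derive f : (forall y i, derivable f y (ecoord R i)) ->
  (forall i, continuous (partial i f)) ->
  forall x v, is_derive x v f (\sum_i partial i f x * v i 0).
Proof.
move=> df cf x v; set l := \sum_i _.
have lim : (fun t : R => t^-1 *: (f (t *: v + x) - f x)) @ 0^' --> l.
  apply/cvgrPdist_le => e e0.
  (* The tolerance is divided by [S + 1] because [S] may vanish. *)
  pose S := \sum_i `|v i 0|; have S0 : 0 <= S by exact: sumr_ge0.
  have e1 : 0 < e / (S + 1) by rewrite divr_gt0 // ltr_wpDl.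
  have [d d0 near_d] := partials_near f x _ cf e1.
  near=> t.
  have t0 : t != 0 by near: t; exact: nbhs_dnbhs_neq.
  have [xi xiv ->] : exists2 xi : 'I_n -> 'cV[R]_n, (forall i, `|xi i - x| <= `|t *: v|) &
    f (t *: v + x) - f x = \sum_i partial i f (xi i) * (t *: v) i 0.
    by rewrite (addrC _ x); exact: coordinate_MVT f x (t *: v) df.
  have -> : l - t^-1 *: (\sum_i partial i f (xi i) * (t *: v) i 0) =
      \sum_i (partial i f x - partial i f (xi i)) * v i 0.
    rewrite /l [_ *: _]mulr_sumr -sumrB; apply: eq_bigr => i _.
    by rewrite mxE; field.
  apply: (le_trans (ler_norm_sum _ _ _)).
  have -> : e = e / (S + 1) * (S + 1) by rewrite divfK // gt_eqF // ltr_wpDl.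
  apply: (@le_trans _ _ (e / (S + 1) * S)); last first.
    by rewrite ler_wpM2l ?(ltW e1) // lerDl.
  rewrite mulr_sumr; apply: ler_sum => i _.
  rewrite normrM ler_wpM2r //; apply: near_d.
  rewrite (le_lt_trans (xiv i)) // normrZ.
  rewrite (@le_lt_trans _ _ (`|t| * (`|v| + 1))) ?ler_wpM2l ?lerDl //.
  rewrite -ltr_pdivlMr ?ltr_wpDl //.
  near: t; apply: dnbhs0_lt; by rewrite divr_gt0 ?ltr_wpDl.
split; first by apply/cvg_ex; exists l.
exact/cvg_lim.
Unshelve. all: by end_near. Qed.

(** Near [x] each partial exceeds its value at [x] by at most 1 in absolute value, so
    [coordinate_MVT] gives the Lipschitz estimate [|f y - f x| <= S |y - x|]. *)
Lemma C1_continuous f : (forall y i, derivable f y (ecoord R i)) ->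
  (forall i, continuous (partial i f)) -> continuous f.
Proof.
move=> df cf x; apply/(cvgrPdist_le (FF := nbhs_filter x)) => e e0.
have [d d0 near_d] := partials_near f x _ cf ltr01.
pose S := \sum_i (`|partial i f x| + 1).
have S0 : 0 <= S by rewrite sumr_ge0 // => i _; rewrite addr_ge0.
have e1 : 0 < e / (S + 1) by rewrite divr_gt0 // ltr_wpDl.
apply/nbhs_ballP; exists (Num.min d (e / (S + 1))) => /=; first by rewrite lt_min d0.
move=> y; rewrite -ball_normE /= distrC lt_min => /andP[yd ye].
have [xi xiv E] := coordinate_MVT f x (y - x) df.
rewrite distrC -[y in f y](subrKC x) E.
apply: (le_trans (ler_norm_sum _ _ _)).
apply: (@le_trans _ _ (S * `|y - x|)).
  rewrite mulr_suml; apply: ler_sum => i _.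
  rewrite normrM ler_pM //; last exact: coord_le_norm.
  rewrite -[X in `|X|](subKr (partial i f x)) (le_trans (ler_normB _ _)) //.
  rewrite lerD2l; apply: near_d.
  by rewrite (le_lt_trans (xiv i)).
apply: (@le_trans _ _ ((S + 1) * `|y - x|)); first by rewrite ler_wpM2r // lerDl.
by rewrite mulrC -ler_pdivlMr ?ltr_wpDl // ltW.
Qed.

End directional_derivatives.

(** * Mixed second differences and the Hessian *)

Section second_derivatives.
Context {R : realType} {n : nat} (h : 'cV[R]_n -> R).
Hypothesis C2h : C2 h.
Implicit Types (x v a b z : 'cV[R]_n).

Lemma C2_is_derive_partial x v i :
  is_derive x v (partial i h) (\sum_j hessian h x i j * v j 0).
Proof.
have [_ [dph cph]] := C2h.
have := C1_is_derive (partial i h) (dph ^~ i) (cph i) x v.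
by congr is_derive; apply: eq_bigr => j _; rewrite mxE.
Qed.

Lemma C2_is_derive x v : is_derive x v h (\sum_i partial i h x * v i 0).
Proof.
have [dh [dph cph]] := C2h.
by apply: C1_is_derive => // i; apply: C1_continuous => [y j|j]; [exact: dph|exact: cph].
Qed.

Lemma C2_is_derive_derive x a b :
  is_derive x b (fun y => \sum_i partial i h y * a i 0) (mxform (hessian h x) a b).
Proof.
have -> : (fun y => \sum_i partial i h y * a i 0) = \sum_i (a i 0 *: partial i h).
  by apply/funext => y; rewrite fct_sumE; apply: eq_bigr => i _; rewrite mulrC.
have -> : mxform (hessian h x) a b = \sum_i a i 0 *: (\sum_j hessian h x i j * b j 0).
  apply: eq_bigr => i _; rewrite [RHS]mulr_sumr; apply: eq_bigr => j _; ring.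
by apply: is_derive_sum => i; apply: is_deriveZ; exact: C2_is_derive_partial.
Qed.

(** The second difference over the parallelogram at [z] with sides [a] and [b]. The inequality in
    [h_monotone] says that such a difference is nonpositive. *)
Definition mixed_diff z a b : R := h (z + a + b) - h (z + a) - h (z + b) + h z.

Lemma mixed_diffC z a b : mixed_diff z a b = mixed_diff z b a.
Proof. by rewrite /mixed_diff (addrAC z); ring. Qed.

(** The mean value theorem along [a] for the increment [h (y + b) - h y]. *)
Lemma mixed_diff_MVT1 z a b : exists2 s : R, 0 < s < 1 &
  mixed_diff z a b = \sum_i partial i h (z + s *: a + b) * a i 0
                     - \sum_i partial i h (z + s *: a) * a i 0.
Proof.
pose f y := h (y + b) - h y.
pose g y := \sum_i partial i h (y + b) * a i 0 - \sum_i partial i h y * a i 0.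
have fg y : is_derive y a f (g y).
  apply: is_deriveB; last exact: C2_is_derive.
  have [dh <-] := C2_is_derive (y + b) a.
  have E : (fun k : R => k^-1 *: (((fun y => h (y + b)) \o shift y) (k *: a) - h (y + b)))
    = (fun k : R => k^-1 *: ((h \o shift (y + b)) (k *: a) - h (y + b))).
    by apply/funext => k /=; rewrite addrA.
  by split; rewrite /derivable /derive E.
have [s s01] := MVT_line f g z a fg _ _ (@ltr01 R).
rewrite scale1r scale0r addr0 subr0 mulr1 => E; exists s => //.
by rewrite -[RHS]E /f /mixed_diff; ring.
Qed.

Lemma mixed_diff_MVT z a b : exists s t : R, [/\ 0 < s < 1, 0 < t < 1 &
  mixed_diff z a b = mxform (hessian h (z + s *: a + t *: b)) a b].
Proof.
have [s s01 ->] := mixed_diff_MVT1 z a b.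
have [t t01] := MVT_line _ _ (z + s *: a) b
  (fun y => C2_is_derive_derive y a b) _ _ (@ltr01 R).
rewrite scale1r scale0r addr0 subr0 mulr1 => E; exists s, t; split => //.
Qed.

(** By homogeneity the Hessian degenerates at the origin when [p > 2], so positivity is available
    only elsewhere. As [b] is nonzero, the segment along [b] meets the origin at most once;
    splitting it there leaves two pieces whose intermediate points avoid the origin. *)
Lemma mixed_diff_gt0 z a b : a != 0 ->
  (forall y, y != 0 -> 0 < mxform (hessian h y) a b) -> 0 < mixed_diff z a b.
Proof.
move=> a0 Hpos.
have b0 : b != 0.
  apply/eqP => b0; have := Hpos a a0.
  by rewrite b0 -(scale0r (0 : 'cV[R]_n)) mxformZr mul0r ltxx.
have [s s01 ->] := mixed_diff_MVT1 z a b.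
set w := z + s *: a; pose k t := \sum_i partial i h (w + t *: b) * a i 0.
have MV (t0 t1 : R) : t0 < t1 -> (forall t, t0 < t < t1 -> w + t *: b != 0) -> k t0 < k t1.
  move=> t01 nz.
  have [t tt E] := MVT_line _ _ w b (fun y => C2_is_derive_derive y a b) _ _ t01.
  rewrite -subr_gt0 E mulr_gt0 ?subr_gt0 //; apply: Hpos; exact: nz.
have <- : k 1 - k 0 = \sum_i partial i h (w + b) * a i 0 - \sum_i partial i h w * a i 0.
  by rewrite /k scale1r scale0r addr0.
rewrite subr_gt0.
have [[t0 [/andP[t00 t01] wt0]]|nz] := pselect (exists t : R, 0 < t < 1 /\ w + t *: b = 0).
- have nz t : t != t0 -> w + t *: b != 0.
    move=> tt0; apply/eqP => wt; have : (t - t0) *: b = 0.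
      by rewrite scalerBl (addrI _ (etrans wt (esym wt0))) subrr.
    by move/eqP; rewrite scaler_eq0 subr_eq0 (negbTE tt0) (negbTE b0).
  apply: (lt_trans (MV _ _ t00 _) (MV _ _ t01 _)) => t /andP[t1 t2]; apply: nz.
    by rewrite lt_eqF.
  by rewrite gt_eqF.
- by apply: MV => // t t01; apply/eqP => wt; apply: nz; exists t.
Qed.

Lemma mxform_ecoord (H : 'M[R]_n) (t : R) i j :
  mxform H (t *: ecoord R i) (t *: ecoord R j) = t ^+ 2 * H i j.
Proof.
rewrite mxformZl mxformZr mulrA expr2; congr (_ * _).
rewrite /mxform (bigD1 i) //= [X in _ + X]big1 ?addr0 => [|k /negbTE ki]; last first.
  by rewrite big1 // => l _; rewrite [ecoord R i k 0]mxE ki mulr0 mul0r.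
rewrite (bigD1 j) //= [X in _ + X]big1 ?addr0 => [|k /negbTE kj]; last first.
  by rewrite [ecoord R j k 0]mxE kj mulr0.
by rewrite !mxE !eqxx !mulr1.
Qed.

(** [mixed_diff] is symmetric in its sides. For sides [t e_i] and [t e_j], the two orders of the
    mean value theorem equate entry [(i, j)] and entry [(j, i)] at two points close to [x];
    continuity of the second partials concludes. *)
Lemma hessian_sym x i j : hessian h x i j = hessian h x j i.
Proof.
have near_ij (k l : 'I_n) (e : R) : 0 < e -> exists2 d : R, 0 < d & forall z, `|z - x| < d ->
    `|hessian h x k l - hessian h z k l| <= e.
  have [_ [_ c2]] := C2h => e0.
  have /(cvgrPdist_le (FF := nbhs_filter x))/(_ _ e0)/nbhs_ballP[d /= d0 dP] := c2 k l x.
  exists d => // z zd; rewrite !mxE; apply: dP.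
  by rewrite -ball_normE /= distrC.
apply/eqP; rewrite -subr_eq0 -normr_le0; apply/ler_addgt0Pl => e e0; rewrite addr0.
have [d1 d10 P1] := near_ij i j _ (divr_gt0 e0 (ltr0n _ 2)).
have [d2 d20 P2] := near_ij j i _ (divr_gt0 e0 (ltr0n _ 2)).
pose d : R := Num.min d1 d2; have d0 : 0 < d by rewrite lt_min d10.
have dd1 : d <= d1 by rewrite ge_min lexx.
have dd2 : d <= d2 by rewrite ge_min lexx orbT.
(* Both intermediate points lie within [2 t < d] of [x]. *)
pose t : R := d / 3.
have t0 : 0 < t by rewrite divr_gt0.
have [s1 [t1 [/andP[s10 s11] /andP[t10 t11] E1]]] :=
  mixed_diff_MVT x (t *: ecoord R i) (t *: ecoord R j).
have [s2 [t2 [/andP[s20 s21] /andP[t20 t21] E2]]] :=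
  mixed_diff_MVT x (t *: ecoord R j) (t *: ecoord R i).
have close (s u : R) k l : 0 < s -> s < 1 -> 0 < u -> u < 1 ->
    `|x + s *: (t *: ecoord R k) + u *: (t *: ecoord R l) - x| < d.
  move=> s0 s1' u0 u1.
  have e_le (m : 'I_n) : `|ecoord R m| <= 1.
    apply: norm_le => // m'; rewrite mxE.
    by case: eqP; rewrite ?andbT /= ?normr0 ?normr1 //; case: eqP.
  rewrite -[x + _ + _]addrA (addrC x) addrK (le_lt_trans (ler_normD _ _)) //.
  have le_t (r : R) (m : 'I_n) : 0 < r -> r < 1 -> `|r *: (t *: ecoord R m)| <= t.
    move=> r0 r1; rewrite scalerA normrZ gtr0_norm ?mulr_gt0 // -mulrA.
    have te : t * `|ecoord R m| <= t by exact: ler_piMr (ltW t0) (e_le m).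
    exact: le_trans (ler_piMl (mulr_ge0 (ltW t0) (normr_ge0 _)) (ltW r1)) te.
  apply: (@le_lt_trans _ _ (t + t)); last by rewrite /t; lra.
  by apply: lerD; exact: le_t.
rewrite mxform_ecoord in E1; rewrite mxform_ecoord in E2.
have t20' : t ^+ 2 != 0 by rewrite expf_neq0 ?gt_eqF.
have E := mulfI t20' (etrans (esym E1) (etrans (mixed_diffC _ _ _) E2)).
have close2 (p q X Y : R) : p = q -> `|X - p| <= e / 2 -> `|Y - q| <= e / 2 ->
    `|X - Y| <= e.
  move=> -> Xq Yq; rewrite -(subrKA q) (le_trans (ler_normD _ _)) // [leRHS]splitr.
  by rewrite lerD // distrC.
exact: close2 E (P1 _ (lt_le_trans (close s1 t1 i j s10 s11 t10 t11) dd1))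
  (P2 _ (lt_le_trans (close s2 t2 j i s20 s21 t20 t21) dd2)).
Qed.

End second_derivatives.

(** * Scaling of the Hessian and the displacement inequality *)

Section homogeneous_cost.
Context {R : realType} {n : nat}.
Implicit Types (h f : 'cV[R]_n -> R) (x y v z : 'cV[R]_n).

(** Both sides are the derivative at 0 of [f (s x + t s e_i) = c f (x + t e_i)] in [t]. *)
Lemma partial_scale f (s c : R) x i : 0 < s ->
  (forall y j, derivable f y (ecoord R j)) ->
  (forall j, continuous (partial j f)) ->
  (forall y, f (s *: y) = c * f y) ->
  partial i f (s *: x) * s = c * partial i f x.
Proof.
move=> s0 df cf fs.
have D1 : is_derive (0 : R) (1 : R) (fun t : R => f (s *: x + t *: (s *: ecoord R i)))
    (partial i f (s *: x) * s).
  apply: is_derive_line; rewrite scale0r addr0.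
  have -> : partial i f (s *: x) * s =
      \sum_j partial j f (s *: x) * (s *: ecoord R i) j 0.
    rewrite (bigD1 i) //= big1 ?addr0 => [|j /negbTE ji].
      by rewrite !mxE !eqxx mulr1.
    by rewrite !mxE ji mulr0 mulr0.
  exact: C1_is_derive.
have D2 : is_derive (0 : R) (1 : R) (fun t : R => c *: f (x + t *: ecoord R i))
    (c *: partial i f x).
  apply: is_deriveZ; apply: is_derive_line; rewrite scale0r addr0.
  exact: is_derive_partial.
have E : (fun t : R => f (s *: x + t *: (s *: ecoord R i))) =
    (fun t : R => c *: f (x + t *: ecoord R i)).
  by apply/funext => t; rewrite [RHS]/GRing.scale /= -fs scalerDr !scalerA (mulrC s).
rewrite -(@derive_val _ _ _ _ _ _ _ D1) E.
exact: (@derive_val _ _ _ _ _ _ _ D2).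
Qed.

Lemma hessian_scale h (p s : R) x i j : C2 h -> 0 < s ->
  (forall y (r : R), 0 < r -> h (r *: y) = r `^ p * h y) ->
  hessian h (s *: x) i j = s `^ p / s ^+ 2 * hessian h x i j.
Proof.
move=> C2h s0 hom; have [dh [dph cph]] := C2h.
have s_neq0 : s != 0 by rewrite gt_eqF.
have hom1 y : partial i h (s *: y) = s `^ p / s * partial i h y.
  apply: (mulIf s_neq0).
  rewrite (@partial_scale h s (s `^ p)) // => [|k|z]; last exact: hom.
    by field.
  by apply: C1_continuous => [z l|l]; [exact: dph|exact: cph].
rewrite !mxE; apply: (mulIf s_neq0).
have := partial_scale (partial i h) s (s `^ p / s) x j s0 (fun y => dph y i) (cph i) hom1.
by move=> ->; field.
Qed.

(** The factor [c] is [|z|^(p-2)], by scaling [z] to the unit sphere. It is left abstract: only its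
    positivity matters, because the same [c] multiplies every term of the displacement estimate. *)
Lemma hessian_elliptic h (p lam Lam : R) : C2 h ->
  (forall y (r : R), 0 < r -> h (r *: y) = r `^ p * h y) ->
  (forall x v, enorm x = 1 ->
     lam * enorm v ^+ 2 <= mxform (hessian h x) v v /\
     mxform (hessian h x) v v <= Lam * enorm v ^+ 2) ->
  forall z, z != 0 -> exists2 c : R, 0 < c &
  forall v, lam * c * enorm v ^+ 2 <= mxform (hessian h z) v v <= Lam * c * enorm v ^+ 2.
Proof.
move=> C2h hom ell z z0.
have s0 : 0 < enorm z by rewrite enorm_gt0.
pose w := (enorm z)^-1 *: z.
have w1 : enorm w = 1 by rewrite enormZ gtr0_norm ?invr_gt0 // mulVf ?gt_eqF.
pose c := enorm z `^ p / enorm z ^+ 2.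
have c0 : 0 < c by rewrite divr_gt0 ?powR_gt0 ?exprn_gt0.
exists c => // v.
have -> : mxform (hessian h z) v v = c * mxform (hessian h w) v v.
  have {1}-> : z = enorm z *: w by rewrite scalerA mulfV ?gt_eqF // scale1r.
  rewrite /mxform mulr_sumr; apply: eq_bigr => i _.
  rewrite mulr_sumr; apply: eq_bigr => j _.
  by rewrite (hessian_scale _ _ _ _ _ _ C2h s0 hom) !mulrA.
have [lo up] := ell w v w1.
by rewrite !(mulrAC _ c) !(mulrC _ c) !ler_pM2l // lo up.
Qed.

(* A too small [uy] would make the mixed second difference of [h] positive. *)
Lemma h_monotone_displacement h (p lam Lam : R) (T : 'cV[R]_n -> set 'cV[R]_n)
    (A : 'M[R]_n) b x y ux uy (del : R) :
  C2 h -> 0 < lam -> lam <= Lam ->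
  (forall y (r : R), 0 < r -> h (r *: y) = r `^ p * h y) ->
  (forall x v, enorm x = 1 ->
     lam * enorm v ^+ 2 <= mxform (hessian h x) v v /\
     mxform (hessian h x) v v <= Lam * enorm v ^+ 2) ->
  h_monotone h T -> T x (A *m x + b + ux) -> T y (A *m y + b + uy) -> 0 < del ->
  enorm (y - x - (del / enorm ux) *: ux) <= lam / (2 * Lam) * del ->
  lam / (4 * Lam) * enorm ux <= enorm uy + 2 * opnorm A * del.
Proof.
move=> C2h lam0 lamLam hom ell mono Tx Ty del0 yclose.
have Lam0 : 0 < Lam by exact: lt_le_trans lamLam.
set a := opnorm A.
have a0 : 0 <= a by exact: opnorm_ge0.
have [->|ux0] := eqVneq ux 0.
  by rewrite enorm0 mulr0 addr_ge0 ?enorm_ge0 // !mulr_ge0 // ltW.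
have U0 : 0 < enorm ux by rewrite enorm_gt0.
rewrite leNgt; apply/negP => small.
pose d := y - x; pose w := (del / enorm ux) *: ux; pose e := d - w.
have nw : enorm w = del by rewrite enormZ gtr0_norm ?divr_gt0 // divfK ?gt_eqF.
have eps_half : lam / (2 * Lam) <= 1 / 2.
  rewrite ler_pdivrMr ?mulr_gt0 //; lra.
have ne : enorm e <= lam / (2 * Lam) * del by [].
have de : d = w + e by rewrite addrC subrK.
have nd : enorm d <= 2 * del.
  rewrite de (le_trans (ler_enormD _ _)) // nw; nra.
(* Since [|e| <= del / 2] and [|w| = del], the displacement [d] cannot vanish, as [mixed_diff_gt0]
   demands. *)
have d0 : d != 0.
  rewrite -enorm_gt0.
  have : enorm w <= enorm d + enorm e.
    by rewrite -(enormN e) (le_trans _ (ler_enormD _ _)) // opprB addrC subrK.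
  rewrite nw; nra.
have := mono _ _ _ _ Tx Ty; apply/negP; rewrite -ltNge.
set xi := A *m x + b + ux; set zeta := A *m y + b + uy.
(* The parallelogram at [x - xi] with sides [y - x] and [xi - zeta] has the four arguments of [h] in
   the monotonicity inequality as its corners. *)
have /(mixed_diff_gt0 _ _ (x - xi)) := d0.
move=> /(_ _ C2h (xi - zeta)).
rewrite /mixed_diff (_ : x - xi + d = y - xi); last by rewrite /d addrC addrA subrK.
rewrite (_ : y - xi + (xi - zeta) = y - zeta); last by rewrite addrA subrK.
rewrite (_ : x - xi + (xi - zeta) = x - zeta); last by rewrite addrA subrK.
suff pos : forall z, z != 0 -> 0 < mxform (hessian h z) d (xi - zeta).
  move=> /(_ pos); lra.
move=> z z0.
have [c c0 Hc] := hessian_elliptic h p lam Lam C2h hom ell z z0.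
set H := hessian h z.
have Hs i j : H i j = H j i by exact: hessian_sym.
have bound v v' : `|mxform H v v'| <= Lam * c * enorm v * enorm v'.
  apply: mxform_bound => // v''; have /andP[lo ->] := Hc v''.
  by rewrite andbT (le_trans _ lo) // !mulr_ge0 ?enorm_ge0 ?ltW ?exprn_ge0 ?enorm_ge0.
have -> : xi - zeta = ux + -1 *: uy + -1 *: (A *m d).
  rewrite /xi /zeta /d mulmxBr !scaleN1r; apply/colP => k; rewrite !mxE; ring.
rewrite mxform_sym // !mxformDl !mxformZl.
(* The part of [d] along [ux] contributes [lam c del |ux|], and the error [e] costs at most half of
   it: this fixes the tolerance [lam / (2 Lam) del]. *)
have B1 : c * del * enorm ux * lam / 2 <= mxform H ux d.
  rewrite de mxformDr /w mxformZr.
  have /andP[lo _] := Hc ux; have := bound ux e; rewrite ler_norml => /andP[lo2 _].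
  have -> : c * del * enorm ux * lam / 2 = (del / enorm ux) * (lam * c * enorm ux ^+ 2)
      - Lam * c * enorm ux * (lam / (2 * Lam) * del).
    by field; rewrite !gt_eqF.
  apply: lerD; first by rewrite ler_wpM2l // divr_ge0 ?ltW.
  rewrite (le_trans _ lo2) // lerN2 ler_wpM2l // !mulr_ge0 ?ltW //.
have B2 : mxform H uy d <= Lam * c * enorm uy * (2 * del).
  rewrite (le_trans (ler_norm _)) // (le_trans (bound _ _)) //.
  by rewrite ler_wpM2l // !mulr_ge0 ?enorm_ge0 ?ltW.
have B3 : mxform H (A *m d) d <= Lam * c * (a * (2 * del)) * (2 * del).
  rewrite (le_trans (ler_norm _)) // (le_trans (bound _ _)) //.
  have nAd : enorm (A *m d) <= a * (2 * del).
    by rewrite (le_trans (enorm_mulmx_le _ _)) // ler_wpM2l.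
  have Lc : 0 <= Lam * c by rewrite mulr_ge0 ?ltW.
  by apply: ler_pM nd; [rewrite mulr_ge0 ?enorm_ge0|exact: enorm_ge0|rewrite ler_wpM2l].
(* The negated conclusion, multiplied by [2 c del Lam], says exactly that the bound [B1] exceeds the
   sum of the bounds [B2] and [B3]. *)
have : 0 < 2 * c * del * Lam * (lam / (4 * Lam) * enorm ux - (enorm uy + 2 * a * del)).
  by rewrite mulr_gt0 ?subr_gt0 // !mulr_gt0.
have -> : 2 * c * del * Lam * (lam / (4 * Lam) * enorm ux - (enorm uy + 2 * a * del))
   = c * del * enorm ux * lam / 2 - Lam * c * enorm uy * (2 * del)
     - Lam * c * (a * (2 * del)) * (2 * del).
  by field; rewrite gt_eqF.
lra.
Qed.

End homogeneous_cost.

(** * The iterated integral as integration against a sigma-finite Borel measure *)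

Local Notation borelType R n := (g_sigma_algebraType (@open 'cV[R]_n)).

Section iterated_integral.
Context {R : realType}.
Local Notation leb := (@lebesgue_measure R).

(** The gluing map under the integral sign in the recursive clause of [lebint]. *)
Definition join_col n (ay : R * 'cV[R]_n) : 'cV[R]_n.+1 :=
  col_mx (const_mx ay.1 : 'cV[R]_1) ay.2.

Lemma join_col0 n (ay : R * 'cV[R]_n) : join_col n ay 0 0 = ay.1.
Proof.
have := col_mxEu (const_mx ay.1 : 'cV[R]_1) ay.2 0 0.
by rewrite [const_mx _ _ _]mxE => <-; congr (col_mx _ _ _ _); apply/val_inj.
Qed.

Lemma join_colS n (ay : R * 'cV[R]_n) i : join_col n ay (lift ord0 i) 0 = ay.2 i 0.
Proof.
have := col_mxEd (const_mx ay.1 : 'cV[R]_1) ay.2 i 0.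
by move=> <-; congr (col_mx _ _ _ _); apply/val_inj.
Qed.

(** [ball] refers to the maximum norm, so it is a cube. Cubes split into products under [join_col],
    which makes their volumes computable by induction on the dimension. *)
Lemma ball_colE n (c x : 'cV[R]_n) (r : R) : 0 < r ->
  ball c r x <-> forall i, ball (c i 0) r (x i 0).
Proof.
move=> r0; split => [[_ cx] i|cx]; first exact: cx.
by split => // i j; rewrite ord1; exact: cx.
Qed.

Lemma ball_join_col n (c : 'cV[R]_n.+1) (r : R) ay : 0 < r ->
  ball c r (join_col n ay) <->
  ball (c 0 0) r ay.1 /\ ball (\col_(i < n) c (lift ord0 i) 0) r ay.2.
Proof.
move=> r0; rewrite !ball_colE //; split => [cb|[b0 bS] i].
  split; first by have := cb 0; rewrite join_col0.
  by move=> i; have := cb (lift ord0 i); rewrite join_colS mxE.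
have [j ->|->] := unliftP ord0 i; last by rewrite join_col0.
by rewrite join_colS; have := bS j; rewrite mxE.
Qed.

Lemma lebint0 n : lebint (fun _ : 'cV[R]_n => 0%E) = 0%E.
Proof.
elim: n => //= n IH; under eq_integral do rewrite IH.
exact: integral0.
Qed.

Lemma lebint_ge0 n (f : 'cV[R]_n -> \bar R) :
  (forall x, (0 <= f x)%E) -> (0 <= lebint f)%E.
Proof. by elim: n f => //= n IH f f0; apply: integral_ge0 => a _; exact: IH. Qed.

Lemma lebvol_ball n (c : 'cV[R]_n) (r : R) : 0 < r ->
  lebvol (ball c r) = ((2 * r) ^+ n)%:E.
Proof.
move=> r0; elim: n c => [|n IH] c.
  have c0 : ball c r 0 by apply: (ball_colE _ _ _ _ r0).2 => -[].
  by rewrite /lebvol /= indicE mem_set.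
pose c' : 'cV[R]_n := \col_(i < n) c (lift ord0 i) 0.
pose c0 := c 0 0; rewrite /lebvol /=.
transitivity (\int[leb]_(a in ball c0 r) (cst ((2 * r) ^+ n)%:E a))%E.
  rewrite [RHS]integral_mkcond; apply: eq_integral => a _.
  rewrite patchE; case: ifPn => [/set_mem ba|nba].
    rewrite -(IH c'); congr lebint; apply/funext => y; rewrite !indicE.
    congr ((nat_of_bool _)%:R%:E).
    apply/idP/idP => /set_mem yb; apply/mem_set.
      by have [] := (ball_join_col _ _ _ (a, y) r0).1 yb.
    exact: (ball_join_col _ _ _ (a, y) r0).2.
  transitivity (lebint (fun _ : 'cV[R]_n => 0%E) : \bar R); last exact: lebint0.
  congr lebint; apply/funext => y; rewrite indicE memNset //.
  move=> yb; have [ba _] := (ball_join_col _ _ _ (a, y) r0).1 yb.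
  by move/negP: nba; apply; apply/mem_set.
rewrite integral_cst; last by rewrite ball_itv; exact: measurable_itv.
rewrite [X in (_ * X)%E](lebesgue_measure_ball c0 (ltW r0)).
by rewrite -EFinM exprSr mulr_natl.
Qed.

Lemma measurable_ball_borel n (c : 'cV[R]_n) (r : R) :
  measurable (ball c r : set (borelType R n)).
Proof. by apply: sub_sigma_algebra; exact: ball_open. Qed.

(* An open set is the union of the rational boxes it contains. *)
Lemma measurable_join_col n :
  measurable_fun setT (join_col n : R * borelType R n -> borelType R n.+1).
Proof.
apply: (@measurability _ _ (R * borelType R n)%type (borelType R n.+1) setT
  (join_col n) (@open 'cV[R]_n.+1) erefl).
move=> _ [V openV <-]; rewrite setTI.
pose rball (qk : 'cV[rat]_n.+1 * nat) : set 'cV[R]_n.+1 :=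
  ball (map_mx ratr qk.1 : 'cV[R]_n.+1) qk.2.+1%:R^-1.
pose B (m : nat) : set (R * borelType R n) :=
  if unpickle m is Some qk then
    if `[< rball qk `<=` V >] then join_col n @^-1` rball qk else set0
  else set0.
have -> : join_col n @^-1` V = \bigcup_m B m.
  apply/seteqP; split => [ay /= Vay|ay [m _]]; last first.
    rewrite /B; case: unpickle => // qk; case: asboolP => // qV; exact: qV.
  have /nbhs_ballP[e /= e0 eV] := open_nbhs_nbhs (conj openV Vay).
  (* With radius below [e / 2], any such cube containing the point stays inside its [e]-ball. *)
  have [k ke] : exists k : nat, k.+1%:R^-1 < e / 2.
    have [k _ /(_ k (leqnn k)) ke] := near_infty_natSinv_lt (PosNum (divr_gt0 e0 (ltr0n R 2))).
    by exists k.
  have k0 : 0 < k.+1%:R^-1 :> R by rewrite invr_gt0 ltr0n.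
  have ratd (a : R) : exists q : rat, `|ratr q - a| < k.+1%:R^-1.
    have [|q] := @rat_in_itvoo R a (a + k.+1%:R^-1); first by rewrite ltrDl.
    rewrite in_itv /= => /andP[aq qa]; exists q.
    by rewrite ger0_norm ?subr_ge0 ?ltW // ltrBlDl.
  pose q : 'cV[rat]_n.+1 := \col_i sval (cid (ratd (join_col n ay i 0))).
  have qay : rball (q, k) (join_col n ay).
    apply: (ball_colE _ _ _ _ k0).2 => i.
      rewrite /= [map_mx _ _ _ _]mxE [q _ _]mxE.
    exact: svalP (cid (ratd (join_col n ay i 0))).
  exists (pickle (q, k)) => //; rewrite /B pickleK asboolT //.
  move=> z qz; apply: eV; rewrite (splitr e).
  have : ball (join_col n ay) (k.+1%:R^-1 + k.+1%:R^-1) z.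
    by apply: (ball_triangle _ qz); exact: ball_sym.
  by apply: le_ball; rewrite lerD // ltW.
apply: bigcupT_measurable => m; rewrite /B; case: unpickle => // -[q k].
case: ifP => // _.
rewrite (_ : _ @^-1` _ = ball ((map_mx ratr q : 'cV[R]_n.+1) 0 0) k.+1%:R^-1 `*`
    ball (\col_(i < n) (map_mx ratr q : 'cV[R]_n.+1) (lift ord0 i) 0) k.+1%:R^-1).
  apply: measurableX; first by rewrite ball_itv; exact: measurable_itv.
  exact: measurable_ball_borel.
have k0 : 0 < k.+1%:R^-1 :> R by rewrite invr_gt0 ltr0n.
apply/seteqP; split => ay; first exact: (ball_join_col _ _ _ _ k0).1.
exact: (ball_join_col _ _ _ _ k0).2.
Qed.

(** Bundles sigma-finiteness with the measure, the form in which the induction of [lebint_measure]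
    passes it to Tonelli's theorem. *)
Lemma sigma_finite_measure_of d (T : measurableType d) (mu : {measure set T -> \bar R}) :
  sigma_finite setT mu ->
  exists nu : {sigma_finite_measure set T -> \bar R}, nu = mu :> (set T -> \bar R).
Proof.
move=> sf.
pose H2 := isSFinite.Build _ _ _ (Measure.sort mu) (sfinite_measure_sigma_finite sf).
pose H3 := isSigmaFinite.Build _ _ _ (Measure.sort mu) sf.
by exists (HB.pack_for (SigmaFiniteMeasure.type T R) (Measure.sort mu) H2 H3).
Qed.

Lemma pushforward_measure_of d d' (T : measurableType d) (T' : measurableType d')
    (mu : {measure set T -> \bar R}) (f : T -> T') : measurable_fun setT f ->
  exists nu : {measure set T' -> \bar R}, nu = pushforward mu f :> (set T' -> \bar R).
Proof.
move=> mf; unshelve eexists (pushforward mu f : {measure set T' -> \bar R}) => //.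
Qed.

(** Dimension 0 is the Dirac mass at the only point. For the successor, push the product of Lebesgue
    measure and the previous measure forward along [join_col]; Tonelli turns its integral into the
    iterated one. *)
Lemma lebint_measure n : exists mu : {sigma_finite_measure set (borelType R n) -> \bar R},
  forall f : borelType R n -> \bar R, measurable_fun setT f ->
    (forall x, (0 <= f x)%E) -> lebint f = (\int[mu]_x f x)%E.
Proof.
elim: n => [|n [mu muE]].
  pose z : borelType R 0 := (0 : 'cV[R]_0).
  have [mu muE] : exists mu : {sigma_finite_measure set (borelType R 0) -> \bar R},
      mu = dirac z :> (set (borelType R 0) -> \bar R).
    apply: (sigma_finite_measure_of _ _ (dirac z)).
    exact: sigma_finiteT.
  exists mu => f mf f0; rewrite muE integral_dirac //.
  by rewrite diracT mul1e.
have [nu nuE] := pushforward_measure_of _ _ _ _ (leb \x mu)%E _ (measurable_join_col n).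
have lebintS (f : borelType R n.+1 -> \bar R) : measurable_fun setT f ->
    (forall x, (0 <= f x)%E) -> lebint f = (\int[nu]_x f x)%E.
  move=> mf f0; rewrite nuE ge0_integral_pushforward //; last exact: measurable_join_col.
  rewrite preimage_setT fubini_tonelli1 //=; last first.
    exact: measurableT_comp mf (measurable_join_col n).
  apply: eq_integral => a _; rewrite muE //.
  exact: measurableT_comp (measurableT_comp mf (measurable_join_col n)) (pair1_measurable a).
(* Sigma-finiteness is recovered from the growing cubes, whose volume is finite by [lebvol_ball]. *)
pose B0 (r : R) : set (borelType R n.+1) := ball (0 : 'cV[R]_n.+1) r.
have mB0 r : measurable (B0 r) by exact: measurable_ball_borel.
have nu_ball (r : R) : 0 < r -> (nu (B0 r) < +oo)%E.
  move=> r0; rewrite -[X in nu X]setIT -integral_indic //.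
  rewrite -lebintS => [|//|x].
  - by rewrite -[lebint _]/(lebvol _) lebvol_ball // ltry.
  - by apply/measurable_EFinP; exact: measurable_indic.
  - by rewrite lee_fin.
have [rho rhoE] : exists rho : {sigma_finite_measure set (borelType R n.+1) -> \bar R},
    rho = nu :> (set _ -> \bar R).
  apply: sigma_finite_measure_of.
  exists (fun k => B0 k.+1%:R) => [|k].
    apply/seteqP; split => // x _.
    exists (Num.truncn `|x|) => //=.
    rewrite /B0 -ball_normE /= sub0r normrN; exact: truncnS_gt.
  by split; [exact: mB0|exact: nu_ball].
by exists rho => f mf f0; rewrite rhoE; exact: lebintS.
Qed.

End iterated_integral.

(** * Measurability, comparison of integrals, and a lower bound for averages *)

Section lebint_estimates.
Context {R : realType} {n : nat}.
Implicit Types (f g : borelType R n -> R) (S N : set 'cV[R]_n).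

Lemma measurable_open_preimage f :
  (forall V : set R, open V -> borel (f @^-1` V)) -> measurable_fun setT f.
Proof.
move=> fV; apply: (measurability _ (RGenOInfty.measurableE R)) => //.
by move=> _ [_ [a ->] <-]; rewrite setTI; apply: fV; exact: interval_open.
Qed.

Lemma measurable_coord (t : 'cV[R]_n -> 'cV[R]_n) i : borel_measurable t ->
  measurable_fun setT (fun x : borelType R n => t x i 0).
Proof.
move=> mt; apply: measurable_open_preimage => V oV.
apply: (mt [set y | V (y i 0)]).
apply: (@open_comp _ _ (fun y : 'cV[R]_n => y i 0) V) => // y _.
exact: coord_continuous.
Qed.

Lemma measurable_enorm (w : 'cV[R]_n -> 'cV[R]_n) :
  (forall i, measurable_fun setT (fun x : borelType R n => w x i 0)) ->
  measurable_fun setT (fun x : borelType R n => enorm (w x)).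
Proof.
move=> mw; apply: (@measurableT_comp _ _ _ _ _ _ (@Num.sqrt R)).
  by apply: continuous_measurable_fun; exact: sqrt_continuous.
by apply: measurable_sum => i; exact: measurable_funX.
Qed.

Lemma borel_measurable_id : @borel_measurable R n n id.
Proof. by move=> V oV; exact: sub_sigma_algebra. Qed.

Lemma measurable_enorm_affine (t : 'cV[R]_n -> 'cV[R]_n) (A : 'M[R]_n) b :
  borel_measurable t ->
  measurable_fun setT (fun x : borelType R n => enorm (t x - A *m x - b)).
Proof.
move=> mt; apply: measurable_enorm => i.
rewrite (_ : (fun _ => _) = (fun x : borelType R n => t x i 0) \-
    (fun x : borelType R n => \sum_j A i j * x j 0 + b i 0)); last first.
  by apply/funext => x; rewrite /= !mxE opprD addrA.
apply: measurable_funB; first exact: measurable_coord.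
apply: measurable_funD; last exact: measurable_cst.
apply: measurable_sum => j; apply: measurable_funM; first exact: measurable_cst.
exact: (measurable_coord id j borel_measurable_id).
Qed.

Lemma measurable_eball (x0 : 'cV[R]_n) (r : R) :
  measurable (eball x0 r : set (borelType R n)).
Proof.
have m : measurable_fun setT (fun x : borelType R n => enorm (x - x0)).
  have := measurable_enorm_affine id 0 x0 borel_measurable_id.
  by under eq_fun do rewrite mul0mx subr0.
have := m measurableT _ (measurable_itv `]-oo, r[); rewrite setTI.
by congr measurable; apply/seteqP; split => x /=; rewrite in_itv.
Qed.

Lemma borel_null (mu : {sigma_finite_measure set (borelType R n) -> \bar R}) N :
  (forall f : borelType R n -> \bar R, measurable_fun setT f ->
    (forall x, (0 <= f x)%E) -> lebint f = (\int[mu]_x f x)%E) ->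
  borel N -> lebvol N = mu N.
Proof.
move=> muE mN; rewrite /lebvol muE => [|| x]; last by rewrite lee_fin.
  by rewrite integral_indic // setIT.
by apply/measurable_EFinP; exact: measurable_indic.
Qed.

Lemma lebint_le_off_null (f1 f2 : borelType R n -> \bar R) N :
  measurable_fun setT f1 -> measurable_fun setT f2 ->
  (forall x, (0 <= f1 x)%E) -> (forall x, (0 <= f2 x)%E) ->
  borel N -> lebvol N = 0%E -> (forall x, ~ N x -> (f1 x <= f2 x)%E) ->
  (lebint f1 <= lebint f2)%E.
Proof.
move=> m1 m2 p1 p2 mN N0 f12; have [mu muE] := @lebint_measure R n.
rewrite !muE //; apply: ae_ge0_le_integral => //.
exists N; split => //; first exact: etrans (esym (borel_null mu N muE mN)) N0.
by move=> x /= nx; apply: contrapT => Nx; apply: nx => _; exact: f12.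
Qed.

Lemma lebvol0 : lebvol (set0 : set 'cV[R]_n) = 0%E.
Proof.
rewrite -(@lebint0 R n); congr lebint.
by apply/funext => x; rewrite indicE in_set0.
Qed.

Lemma borel0 : borel (set0 : set 'cV[R]_n).
Proof. exact: (@measurable0 _ (borelType R n)). Qed.

Lemma measurable_indic_mul S f : borel S -> measurable_fun setT f ->
  measurable_fun setT (fun x : borelType R n => ((\1_S x)%:E * (f x)%:E)%E).
Proof.
move=> mS mf; apply/measurable_EFinP.
by apply: measurable_funM => //; exact: measurable_indic.
Qed.

Lemma indic_mul_ge0 S f : (forall x, 0 <= f x) ->
  forall x, (0 <= (\1_S x)%:E * (f x)%:E :> \bar R)%E.
Proof. by move=> f0 x; rewrite -EFinM lee_fin mulr_ge0. Qed.

Lemma lebint_cst_ball (z : 'cV[R]_n) (rho c : R) : 0 < rho -> 0 <= c ->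
  setint (ball z rho) (fun _ => c%:E) = (c * (2 * rho) ^+ n)%:E.
Proof.
move=> rho0 c0; have [mu muE] := @lebint_measure R n.
have mb := measurable_ball_borel n z rho.
rewrite /setint muE; last 2 first.
- exact: measurable_indic_mul.
- exact: indic_mul_ge0.
under eq_integral do rewrite muleC.
rewrite ge0_integralZl //; last 1 first.
- by apply/measurable_EFinP; exact: measurable_indic.
rewrite integral_indic // setIT [X in (_ * X)%E](esym (borel_null mu _ muE mb)).
by rewrite lebvol_ball // -EFinM.
Qed.

(** The Euclidean norm is at most the sum of [n] coordinates; dividing by [n + 1] instead of [n]
    covers dimension 0. *)
Lemma ball_sub_eball (z : 'cV[R]_n) (r : R) : 0 < r ->
  ball z (r / n.+1%:R) `<=` [set y | enorm (y - z) <= r].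
Proof.
move=> r0 y zy /=; rewrite (le_trans (enorm_le_sum _)) //.
have rn : 0 < r / n.+1%:R by rewrite divr_gt0.
apply: (@le_trans _ _ (\sum_(i < n) r / n.+1%:R)).
  apply: ler_sum => i _; have := (ball_colE _ _ _ _ rn).1 zy i.
  by rewrite /ball /= distrC !mxE => /ltW.
rewrite sumr_const card_ord -[_ *+ n]mulr_natr mulrAC ler_pdivrMr //.
by rewrite ler_wpM2l ?(ltW r0) // ler_nat.
Qed.

Lemma eball_sub_ball (x0 : 'cV[R]_n) (r : R) : 0 < r -> eball x0 r `<=` ball x0 r.
Proof.
move=> r0 x xr; apply: (ball_colE _ _ _ _ r0).2 => i.
rewrite /ball /= distrC; apply: le_lt_trans xr.
by have := coord_le_enorm (x - x0) i; rewrite !mxE.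
Qed.

(** A Chebyshev bound: the integral is at least [c (2 rho)^n], while the Euclidean ball lies in a
    cube of volume [(2 r)^n]. The powers of 2 cancel, so the exact volume of the ball is never
    computed. *)
Lemma average_ge_of_ball (x0 z : 'cV[R]_n) (r rho c : R) g N :
  0 < r -> 0 < rho -> 0 <= c -> ball z rho `<=` eball x0 r ->
  measurable_fun setT g -> (forall x, 0 <= g x) ->
  (setint (eball x0 r) (fun x => (g x)%:E) < +oo)%E ->
  borel N -> lebvol N = 0%E -> (forall y, ball z rho y -> ~ N y -> c <= g y) ->
  c * rho ^+ n <= average (eball x0 r) g * r ^+ n.
Proof.
move=> r0 rho0 c0 zr mg g0 fing mN N0 cg.
have mS := measurable_eball x0 r.
have mb := measurable_ball_borel n z rho.
have mb0 := measurable_ball_borel n x0 r.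
have lo : ((c * (2 * rho) ^+ n)%:E <= setint (eball x0 r) (fun x => (g x)%:E))%E.
  rewrite -(lebint_cst_ball z) //; apply: (lebint_le_off_null _ _ N) => //.
  - exact: measurable_indic_mul.
  - exact: measurable_indic_mul.
  - exact: indic_mul_ge0.
  - exact: indic_mul_ge0.
  - move=> x Nx; rewrite -!EFinM lee_fin !indicE.
    have [xb|xb] := pselect (ball z rho x); last by rewrite (memNset xb) mul0r mulr_ge0.
    by rewrite (mem_set xb) (mem_set (zr _ xb)) !mul1r cg.
have vol_le (S1 S2 : set 'cV[R]_n) : borel S1 -> borel S2 -> S1 `<=` S2 ->
    (lebvol S1 <= lebvol S2)%E.
  move=> m1 m2 S12; apply: (lebint_le_off_null _ _ set0) => //.
  - by apply/measurable_EFinP; exact: measurable_indic.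
  - by apply/measurable_EFinP; exact: measurable_indic.
  - exact: borel0.
  - exact: lebvol0.
  - move=> x _; rewrite lee_fin !indicE.
    have [xb|xb] := pselect (S1 x); last by rewrite (memNset xb).
    by rewrite (mem_set xb) (mem_set (S12 _ xb)).
(* This makes the volume positive and [v2] makes it finite, so with the finite integral no [fine] in
   [average] falls back to 0. *)
have v1 : (((2 * rho) ^+ n)%:E <= lebvol (eball x0 r))%E.
  by rewrite -(lebvol_ball n z) //; exact: vol_le.
have v2 : (lebvol (eball x0 r) <= ((2 * r) ^+ n)%:E)%E.
  by rewrite -(lebvol_ball n x0) //; apply: vol_le => //; exact: eball_sub_ball.
rewrite /average.
move: lo fing v1 v2; case: (setint _ _) => [I| |] //.
case: (lebvol _) => [v| |] //; rewrite !lee_fin => lo _ v1 v2 /=.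
have v0 : 0 < v by apply: lt_le_trans v1; rewrite exprn_gt0 // mulr_gt0.
have I0 : 0 <= I by apply: le_trans lo; rewrite mulr_ge0 // exprn_ge0 // mulr_ge0 // ltW.
move: lo v2; rewrite !exprMn => lo v2.
have p2 : 0 < 2 ^+ n :> R by rewrite exprn_gt0.
rewrite -(ler_pM2l p2) mulrCA (le_trans lo) // mulrCA.
by rewrite -mulrA ler_peMr // mulrC ler_pdivlMr // mul1r.
Qed.

End lebint_estimates.

(** * Integrability of the power of [|u|] on balls *)

Section local_integrability.
Context {R : realType} {n : nat}.

Lemma closed_box_compact (c : 'cV[R]_n) (r : R) :
  compact [set x : 'cV[R]_n | forall i, x i 0 \in `[c i 0 - r, c i 0 + r]].
Proof.
have := @rV_compact R n (fun i => `[c i 0 - r, c i 0 + r]%classic)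
  (fun i => @segment_compact R _ _).
have trc : continuous (@trmx R 1 n).
  move=> M s /= /(nbhs_ballP M^T)[e /= e0 es]; apply/nbhs_ballP; exists e => //= N [_ MN].
  by apply: es; split => // i j; rewrite !mxE.
move=> /(continuous_compact (continuous_subspaceT trc)); congr compact.
apply/seteqP; split => [_ [v vb <-] i|x xb /=]; first by rewrite mxE; exact: vb.
by exists x^T; rewrite ?trmxK // => i /=; rewrite mxE; exact: xb.
Qed.

(** The sum is at most twice the larger term. *)
Lemma powRD_le (q x y : R) : 0 <= q -> 0 <= x -> 0 <= y ->
  (x + y) `^ q <= 2 `^ q * (x `^ q + y `^ q).
Proof.
move=> q0 x0 y0.
have key (s t : R) : 0 <= s -> 0 <= t -> s <= t -> (s + t) `^ q <= 2 `^ q * (s `^ q + t `^ q).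
  move=> s0 t0 st; apply: (@le_trans _ _ ((2 * t) `^ q)).
    by apply: ge0_ler_powR; rewrite ?nnegrE ?addr_ge0 ?mulr_ge0 //; lra.
  by rewrite powRM // ler_wpM2l ?powR_ge0 // lerDr powR_ge0.
have [xy|/ltW yx] := leP x y; first exact: key.
by rewrite addrC [_ `^ q + _]addrC; exact: key.
Qed.

(** On the ball the affine part is bounded by a constant [M], and [t] is integrable on a compact
    cube containing the ball; [powRD_le] combines the two. *)
Lemma Lloc_affine_integrable (q : R) (t : 'cV[R]_n -> 'cV[R]_n) (A : 'M[R]_n) b x0 (r : R) :
  0 <= q -> 0 < r -> Lloc q t ->
  (setint (eball x0 r) (fun x => (enorm (t x - A *m x - b)%R `^ q)%:E) < +oo)%E.
Proof.
move=> q0 r0 [mt tK].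
pose K := [set x : 'cV[R]_n | forall i, x i 0 \in `[x0 i 0 - r, x0 i 0 + r]].
have cK : compact K by exact: closed_box_compact.
have := tK K cK.
pose M := opnorm A * r + enorm (A *m x0 + b).
have [mu muE] := @lebint_measure R n.
have mS := measurable_eball x0 r.
have mB := measurable_ball_borel n x0 r.
have mpow (w : borelType R n -> R) : measurable_fun setT w ->
    measurable_fun setT (fun x : borelType R n => w x `^ q).
  move=> mw; exact: (@measurableT_comp _ _ _ _ _ _ (fun a : R => a `^ q) setT w
    (measurable_powR q) mw).
have mtq : measurable_fun setT (fun x : borelType R n => enorm (t x) `^ q).
  by apply: mpow; apply: measurable_enorm => i; exact: measurable_coord.
have muq : measurable_fun setT (fun x : borelType R n => enorm (t x - A *m x - b) `^ q).
  by apply: mpow; exact: measurable_enorm_affine.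
have mKb : borel K.
  have -> : K = \bigcap_(i : 'I_n)
      ((fun x : borelType R n => x i 0) @^-1` `[x0 i 0 - r, x0 i 0 + r]).
    by apply/seteqP; split => x xK i; [move=> _|]; exact: xK.
  apply: (@fin_bigcap_measurable _ (borelType R n)) => [|i _]; first exact: finite_finset.
  rewrite -[X in measurable X]setTI.
  by apply: (measurable_coord id i borel_measurable_id) => //; exact: measurable_itv.
have m1 := measurable_indic_mul _ _ mS muq.
have m2 := measurable_indic_mul _ _ mKb mtq.
have mc : measurable_fun setT (fun x : borelType R n => M `^ q) by exact: measurable_cst.
have m3 := measurable_indic_mul _ _ mB mc.
have p1 := indic_mul_ge0 (eball x0 r) (fun x => enorm (t x - A *m x - b) `^ q)
  (fun x => powR_ge0 _ _).
have p2 := indic_mul_ge0 K (fun x => enorm (t x) `^ q) (fun x => powR_ge0 _ _).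
have p3 := indic_mul_ge0 (ball x0 r) (fun x => M `^ q) (fun x => powR_ge0 _ _).
rewrite /setint (muE _ m1 p1) (muE _ m2 p2) => fin2.
have fin3 : (\int[mu]_x ((\1_(ball x0 r) x)%:E * (M `^ q)%:E) < +oo)%E.
  rewrite -(muE _ m3 p3) -[lebint _]/(setint _ (fun=> (M `^ q)%:E)).
  by rewrite lebint_cst_ball ?ltry // powR_ge0.
have m23 := emeasurable_funD m2 m3.
apply: (@le_lt_trans _ _ (\int[mu]_x ((2 `^ q)%:E *
    ((\1_K x)%:E * (enorm (t x) `^ q)%:E + (\1_(ball x0 r) x)%:E * (M `^ q)%:E)))%E).
  apply: ge0_le_integral => //.
  - exact: measurable_funeM.
  - move=> x _; rewrite -!EFinM lee_fin !indicE.
    have [xS|xS] := pselect (eball x0 r x); last first.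
      by rewrite (memNset xS) mul0r mulr_ge0 ?powR_ge0 // addr_ge0 ?mulr_ge0 ?powR_ge0.
    have xB := eball_sub_ball _ _ r0 x xS.
    have xK : K x.
      move=> i; have := (ball_colE _ _ _ _ r0).1 xB i.
      rewrite /ball /= distrC ltr_norml in_itv /= => /andP[l1 l2].
      by apply/andP; split; lra.
    rewrite (mem_set xS) (mem_set xB) (mem_set xK) !mul1r.
    have xM : enorm (A *m x + b) <= M.
      rewrite -[x](subrK x0) mulmxDr -addrA (le_trans (ler_enormD _ _)) // lerD2r.
      by rewrite (le_trans (enorm_mulmx_le _ _)) // ler_wpM2l ?opnorm_ge0 // ltW.
    have M0 : 0 <= M by exact: le_trans (enorm_ge0 _) xM.
    apply: (le_trans _ (powRD_le _ _ _ q0 (enorm_ge0 _) M0)).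
    apply: ge0_ler_powR; rewrite ?nnegrE ?addr_ge0 ?enorm_ge0 ?mulr_ge0 ?opnorm_ge0 ?(ltW r0) //.
    by rewrite -addrA -opprD (le_trans (ler_enormD _ _)) // enormN lerD2l.
rewrite ge0_integralZl ?lee_fin ?powR_ge0 //; last by move=> x _; rewrite adde_ge0.
rewrite ge0_integralD //.
rewrite lte_mul_pinfty ?lee_fin ?powR_ge0 //.
by rewrite lte_add_pinfty.
Qed.

End local_integrability.

(** * Choice of the displacement length [del] *)

Section optimization.
Context {R : realType} {n : nat}.
Variables (q s : R).
Hypotheses (q1 : 1 <= q) (s0 : 0 < s) (s1 : s <= 1).

Let q0 : 0 < q. Proof. exact: lt_le_trans q1. Qed.

Lemma powR_le_cancel (x y : R) : 0 <= x -> 0 <= y -> x `^ q <= y `^ q -> x <= y.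
Proof.
move=> x0 y0; apply: contra_le => yx.
by apply: gt0_ltr_powR; rewrite ?nnegrE.
Qed.

Lemma powR_invK (x y : R) : 0 <= x -> 0 < y -> (x `^ (1 / y)) `^ y = x.
Proof. by move=> x0 y0; rewrite -powRrM div1r mulVf ?gt_eqF // powRr1. Qed.

Lemma powR_Kinv (x y : R) : 0 <= x -> 0 < y -> (x `^ y) `^ (1 / y) = x.
Proof. by move=> x0 y0; rewrite -powRrM div1r mulfV ?gt_eqF // powRr1. Qed.

Variables (c1 a kap r m U : R).
Hypotheses (c10 : 0 < c1) (a0 : 0 <= a) (kap1 : 1 <= kap) (r0 : 0 < r) (m0 : 0 <= m).
Hypothesis step : forall del, 0 < del -> del <= s * r -> 0 <= c1 * U - 2 * a * del ->
  (c1 * U - 2 * a * del) `^ q * del ^+ n <= kap * m * r ^+ n.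

(** The threshold: [m^(1/q) = C r] is equivalent to the optimal length [r (r^(-q) m)^(1/(n+q))]
    being the largest admissible one, [s r]. *)
Let C := s `^ ((n%:R + q) / q).

(** The length [D] solves [D^(n+q) = m r^n], so [step] reads [V^q <= kap D^q] with
    [V = c1 U - 2 a D]. Since [kap >= 1] and [q >= 1], this gives [V <= kap D], of the same order as
    the error [2 a D]. *)
Lemma optimal_step : m `^ (1 / q) <= C * r ->
  U <= (kap + 2 * a) / c1 * r * (r `^ (- q) * m) `^ (1 / (n%:R + q)).
Proof.
move=> mC; set w := r `^ (- q) * m.
have nq0 : 0 < n%:R + q by rewrite ltr_wpDl.
have w0 : 0 <= w by rewrite mulr_ge0 ?powR_ge0.
have rq0 : 0 < r `^ q by rewrite powR_gt0.
have wE : m = w * r `^ q by rewrite /w powRN mulrAC mulVf ?mul1r // gt_eqF.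
pose D := r * w `^ (1 / (n%:R + q)).
have Ds : D <= s * r.
  rewrite /D mulrC ler_pM2r // -[s in _ <= s](@powR_Kinv s (n%:R + q) (ltW s0) nq0).
  apply: ge0_ler_powR; rewrite ?nnegrE ?powR_ge0 ?divr_ge0 ?(ltW nq0) //.
  rewrite -(ler_pM2r rq0) -wE -(@powR_invK m q) //.
  have -> : s `^ (n%:R + q) * r `^ q = (C * r) `^ q.
    by rewrite powRM ?powR_ge0 ?(ltW r0) // /C -powRrM divfK // gt_eqF.
  apply: ge0_ler_powR; rewrite ?nnegrE ?mulr_ge0 ?powR_ge0 ?(ltW q0) ?(ltW r0) //.
rewrite -mulrA -/D mulrAC ler_pdivlMr // mulrC.
have D_ge0 : 0 <= D by rewrite mulr_ge0 ?powR_ge0 ?(ltW r0).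
(* If the mean vanishes then [D = 0] is not admissible; a small positive length then contradicts
   [step] unless [U <= 0]. *)
have [w_eq0|w_neq0] := eqVneq w 0.
  have -> : D = 0 by rewrite /D w_eq0 powR0 ?mulr0 // gt_eqF // divr_gt0.
  rewrite mulr0 leNgt; apply/negP => U0.
  (* Small enough that [2 a d] takes at most half of [c1 U]; the [+ 1] allows [a = 0]. *)
  pose d := Num.min (s * r) (c1 * U / (2 * a + 1) / 2).
  have a1 : 0 < 2 * a + 1 by rewrite ltr_wpDl ?mulr_ge0.
  have d0 : 0 < d by rewrite lt_min !divr_gt0 // mulr_gt0.
  have ds : d <= s * r by rewrite ge_min lexx.
  have dU : d <= c1 * U / (2 * a + 1) / 2 by rewrite ge_min lexx orbT.
  have V0 : 0 < c1 * U - 2 * a * d.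
    have : 2 * a * d <= c1 * U / 2.
      apply: (@le_trans _ _ ((2 * a + 1) * d)); first by rewrite ler_pM2r //; lra.
      rewrite -ler_pdivlMl //; apply: (le_trans dU).
      by rewrite le_eqVlt; apply/orP; left; apply/eqP; field; rewrite gt_eqF.
    lra.
  have := step _ d0 ds (ltW V0); rewrite wE w_eq0 mul0r mulr0 mul0r.
  by rewrite leNgt mulr_gt0 ?powR_gt0 // exprn_gt0.
have D0 : 0 < D by rewrite mulr_gt0 // powR_gt0 // lt0r w_neq0.
have DE : m * r ^+ n = D ^+ n * D `^ q.
  rewrite -!powR_mulrn ?(ltW r0) // -powRD; last by rewrite gt_eqF.
  rewrite /D powRM ?powR_ge0 ?(ltW r0) // powR_invK // powRD ?gt_eqF //.
  by rewrite wE; ring.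
have k0 : 0 <= kap by exact: le_trans ler01 kap1.
have kD : 0 <= kap * D by rewrite mulr_ge0.
have [V0|V0] := ltP (c1 * U - 2 * a * D) 0; first by lra.
have := step _ D0 Ds V0; rewrite -(mulrA kap) DE (mulrC (D ^+ n)) (mulrA kap).
rewrite ler_pM2r ?exprn_gt0 // => VD.
have : c1 * U - 2 * a * D <= kap * D.
  apply: powR_le_cancel => //.
  apply: (le_trans VD); rewrite (powRM _ k0 D_ge0) ler_wpM2r ?powR_ge0 //.
  by rewrite -{1}(powRr1 k0) ler_powR.
lra.
Qed.

(** Use the largest length [s r]. The error [2 a s r] is absorbed because here [r] is at most
    [m^(1/q) / C]. *)
Lemma maximal_step : C * r <= m `^ (1 / q) ->
  U <= (kap * s ^- n + 2 * a * s / C) / c1 * r * (r `^ (- q) * m) `^ (1 / q).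
Proof.
set mq := m `^ (1 / q) => mC.
have mq0 : 0 <= mq by rewrite powR_ge0.
have C0 : 0 < C by rewrite powR_gt0.
have -> : (r `^ (- q) * m) `^ (1 / q) = r^-1 * mq.
  rewrite powRM ?powR_ge0 // -powRrM mulrA mulr1 mulNr mulfV ?gt_eqF //.
  by rewrite powR_inv1 // ltW.
rewrite mulrA mulfK ?gt_eqF // mulrAC ler_pdivlMr // mulrC.
pose D := s * r; have D0 : 0 < D by rewrite mulr_gt0.
have aD : 2 * a * D <= 2 * a * s / C * mq.
  have -> : 2 * a * s / C * mq = 2 * a * s * (mq / C) by ring.
  by rewrite /D mulrA ler_wpM2l ?mulr_ge0 ?(ltW s0) // ler_pdivlMr // mulrC.
have k0 : 0 <= kap by exact: le_trans ler01 kap1.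
have Ks0 : 0 <= kap * s ^- n by rewrite mulr_ge0 // invr_ge0 exprn_ge0 ?(ltW s0).
have [V0|V0] := ltP (c1 * U - 2 * a * D) 0.
  have := mulr_ge0 Ks0 mq0; lra.
suff : c1 * U - 2 * a * D <= kap * s ^- n * mq by lra.
have sn : 0 < s ^+ n by rewrite exprn_gt0.
have rn : 0 < r ^+ n by rewrite exprn_gt0.
have sV1 : 1 <= s ^- n by rewrite invf_ge1 // exprn_ile1 // ltW.
(* A number that is at least 1 is bounded by its own [q]-th power, which lets the constant pass
   under the power. *)
have K1 : 1 <= kap * s ^- n by rewrite -[1]mulr1 ler_pM.
apply: (powR_le_cancel _ _ V0 (mulr_ge0 Ks0 mq0)).
rewrite (powRM _ Ks0 mq0) (powR_invK _ _ m0 q0).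
apply: (@le_trans _ _ (kap * s ^- n * m)); last first.
  rewrite ler_wpM2r // -{1}[kap * s ^- n]powRr1 // ler_powR //.
rewrite (mulrAC kap) ler_pdivlMr // -(ler_pM2r rn) -[_ * s ^+ n * _]mulrA -exprMn.
exact: step.
Qed.

End optimization.

(** * Averaging the displacement inequality, and the bound on the supremum *)

(** Off the null set, [h_monotone_displacement] gives [|u y| >= V] throughout a cube centred at the
    displaced point, and [average_ge_of_ball] with [c = V^(p-1)] converts this into a bound by the
    mean. *)
Lemma displacement_average (R : realType) (n : nat) (p lam Lam : R)
    (h : 'cV[R]_n -> R) (T : 'cV[R]_n -> set 'cV[R]_n) (t : 'cV[R]_n -> 'cV[R]_n)
    (A : 'M[R]_n) (b : 'cV[R]_n) (N : set 'cV[R]_n) (x0 x : 'cV[R]_n) (r del : R) :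
  2 <= p -> C2 h -> 0 < lam -> lam <= Lam ->
  (forall y (s : R), 0 < s -> h (s *: y) = s `^ p * h y) ->
  (forall y v, enorm y = 1 ->
     lam * enorm v ^+ 2 <= mxform (hessian h y) v v /\
     mxform (hessian h y) v v <= Lam * enorm v ^+ 2) ->
  h_monotone h T -> borel N -> lebvol N = 0%E -> (forall y, ~ N y -> T y (t y)) ->
  Lloc (p - 1) t -> ~ N x -> 0 < r -> 0 < del -> enorm (x - x0) + 2 * del < r ->
  let u := fun y => t y - A *m y - b in
  let V := lam / (4 * Lam) * enorm (u x) - 2 * opnorm A * del in
  0 <= V ->
  V `^ (p - 1) * (lam / (2 * Lam) * del / n.+1%:R) ^+ n
    <= average (eball x0 r) (fun y => enorm (u y) `^ (p - 1)) * r ^+ n.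
Proof.
move=> p2 C2h lam0 lamLam hom ell mono mN N0 NT Lt Nx r0 del0 xr u V V0.
have q0 : 0 <= p - 1 by lra.
have Lam0 : 0 < Lam by exact: lt_le_trans lamLam.
have rho0 : 0 < lam / (2 * Lam) * del by rewrite mulr_gt0 // divr_gt0 // mulr_gt0.
have rho_le : lam / (2 * Lam) * del <= del.
  rewrite ler_piMl ?(ltW del0) // ler_pdivrMr ?mulr_gt0 //; lra.
have T_affine y : ~ N y -> T y (A *m y + b + u y).
  by move=> /NT; congr (T y _); rewrite /u; apply/colP => k; rewrite !mxE; ring.
(* If [u x = 0] then [z = x], and the estimates below still hold. *)
pose z := x + (del / enorm (u x)) *: u x.
apply: (average_ge_of_ball x0 z r _ _ (fun y => enorm (u y) `^ (p - 1)) N) => //.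
- by rewrite divr_gt0.
- exact: powR_ge0.
- move=> y /(ball_sub_eball _ _ rho0) /= yz; rewrite /eball /=.
  have -> : y - x0 = (y - z) + ((del / enorm (u x)) *: u x + (x - x0)).
    by rewrite /z; apply/colP => k; rewrite !mxE; ring.
  rewrite (le_lt_trans (ler_enormD _ _)) //.
  have zx : enorm ((del / enorm (u x)) *: u x) <= del.
    rewrite enormZ ger0_norm ?divr_ge0 ?enorm_ge0 ?(ltW del0) //.
    have [->|ux0] := eqVneq (enorm (u x)) 0; first by rewrite mulr0 ltW.
    by rewrite divfK.
  have := ler_enormD ((del / enorm (u x)) *: u x) (x - x0); lra.
- apply: (@measurableT_comp _ _ _ _ _ _ (fun c : R => c `^ (p - 1))).
    exact: measurable_powR.
  by apply: measurable_enorm_affine; case: Lt.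
- by move=> y; exact: powR_ge0.
- exact: Lloc_affine_integrable.
- move=> y /(ball_sub_eball _ _ rho0) /= yz Ny.
  apply: ge0_ler_powR; rewrite ?nnegrE ?enorm_ge0 //.
  rewrite /V lerBlDr.
  apply: (h_monotone_displacement h p lam Lam T A b x y (u x) (u y) del) => //.
  + exact: T_affine.
  + exact: T_affine.
  + by rewrite -addrA -opprD.
Qed.

Theorem theorem3p1 (R : realType) (n : nat) (p : R) :
  2 <= p ->
  exists C : R -> R, (forall beta, 0 < beta < 1 -> 0 < C beta) /\
  forall lam Lam a : R, 0 < lam -> lam <= Lam -> 0 <= a ->
  exists K1 : R, 0 < K1 /\
  exists K2 : R -> R, (forall beta, 0 < beta < 1 -> 0 < K2 beta) /\
  forall (h : 'cV[R]_n -> R) (T : 'cV[R]_n -> set 'cV[R]_n)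
         (t : 'cV[R]_n -> 'cV[R]_n) (A : 'M[R]_n) (b : 'cV[R]_n) (beta : R),
    C2 h ->
    (forall x, 0 <= h x) ->
    (forall x (s : R), 0 < s -> h (s *: x) = s `^ p * h x) ->
    (forall x v : 'cV[R]_n, enorm x = 1 ->
       lam * enorm v ^+ 2 <= \sum_i \sum_j hessian h x i j * v i 0 * v j 0 /\
       \sum_i \sum_j hessian h x i j * v i 0 * v j 0 <= Lam * enorm v ^+ 2) ->
    h_monotone h T ->
    lebnull [set x | ~ T x (t x)] ->
    Lloc (p - 1) t ->
    opnorm A = a ->
    0 < beta < 1 ->
    forall (x0 : 'cV[R]_n) (r : R), 0 < r ->
    let u := fun x => t x - A *m x - b in
    let m := average (eball x0 r) (fun x => enorm (u x) `^ (p - 1)) in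
    (m `^ (1 / (p - 1)) <= C beta * r ->
       (esssup (eball x0 (beta * r)) (fun x => enorm (u x))
         <= (K1 * r * (r `^ (- (p - 1)) * m) `^ (1 / (n%:R + p - 1)))%:E)%E) /\
    (C beta * r <= m `^ (1 / (p - 1)) ->
       (esssup (eball x0 (beta * r)) (fun x => enorm (u x))
         <= (K2 beta * r * (r `^ (- (p - 1)) * m) `^ (1 / (p - 1)))%:E)%E).
Proof.
move=> p2; pose q := p - 1.
have q1 : 1 <= q by rewrite /q; lra.
have q0 : 0 < q by exact: lt_le_trans q1.
have nq0 : 0 < n%:R + q by rewrite ltr_wpDl.
(* [del <= (1 - beta) r / 3] keeps the points [y] strictly inside the ball. *)
pose s (beta : R) := (1 - beta) / 3.
have s_pos beta : 0 < beta < 1 -> 0 < s beta <= 1 by rewrite /s; lra.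
pose C (beta : R) := s beta `^ ((n%:R + q) / q).
have C_pos beta : 0 < beta < 1 -> 0 < C beta.
  by move=> /s_pos /andP[s0 _]; exact: powR_gt0.
exists C; split => // lam Lam a lam0 lamLam a0.
have Lam0 : 0 < Lam by exact: lt_le_trans lamLam.
(* [c1] is the coefficient of [|ux|] in the displacement inequality; [kap] is the [n]-th power of
   the ratio of [del] to the radius of the cube in [displacement_average]. *)
pose c1 := lam / (4 * Lam); pose kap := (n.+1%:R * (2 * Lam) / lam) ^+ n.
have c10 : 0 < c1 by rewrite divr_gt0 // mulr_gt0.
have kap1 : 1 <= kap.
  rewrite exprn_ege1 // ler_pdivlMr // mul1r.
  have : 1 <= n.+1%:R :> R by rewrite ler1n.
  nra.
(* This constant is free of [beta]: the optimal length does not involve [s], which only decides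
   whether that length is admissible. *)
exists ((kap + 2 * a) / c1); split; first by rewrite divr_gt0 //; lra.
exists (fun beta => (kap * s beta ^- n + 2 * a * s beta / C beta) / c1); split.
  move=> beta b01; have /andP[s0 _] := s_pos _ b01; have C0 := C_pos _ b01.
  have e0 : 0 <= 2 * a * s beta / C beta.
    by apply: divr_ge0 (ltW C0); apply: mulr_ge0 (ltW s0); exact: mulr_ge0.
  apply: divr_gt0 c10; apply: ltr_pwDl e0.
  by rewrite mulr_gt0 ?(lt_le_trans ltr01 kap1) // invr_gt0 exprn_gt0.
move=> h T t A b beta C2h _ hom ell mono [N [mN [TN N0]]] Lt Aa b01 x0 r r0 u m.
have /andP[s0 s1] := s_pos _ b01.
have m0 : 0 <= m.
  rewrite /m /average.
  by rewrite divr_ge0 // fine_ge0 //; apply: lebint_ge0 => x;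
    rewrite -?EFinM lee_fin ?mulr_ge0 ?powR_ge0.
have NT y : ~ N y -> T y (t y) by move=> Ny; apply: contrapT => /TN.
have bound x : eball x0 (beta * r) x -> ~ N x -> forall del, 0 < del -> del <= s beta * r ->
    0 <= c1 * enorm (u x) - 2 * a * del ->
    (c1 * enorm (u x) - 2 * a * del) `^ q * del ^+ n <= kap * m * r ^+ n.
  move=> xr Nx del del0 dels V0.
  have xdel : enorm (x - x0) + 2 * del < r.
    have := xr : enorm (x - x0) < beta * r; move: dels; rewrite /s.
    by move: b01 => /andP[b0 b1]; nra.
  move: V0; rewrite -Aa => V0.
  have := displacement_average R n p lam Lam h T t A b N x0 x r del p2 C2h lam0 lamLam
    hom ell mono mN N0 NT Lt Nx r0 del0 xdel V0.
  rewrite -/m -/q -/c1 -/u => le.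
  have k0 : 0 < kap by exact: lt_le_trans ltr01 kap1.
  rewrite -[kap * m * _]mulrA; move: le; rewrite -(ler_pM2l k0); apply: le_trans.
  rewrite mulrCA /kap -exprMn le_eqVlt; apply/orP; left; apply/eqP.
  congr (_ * _ ^+ n); field; rewrite !gt_eqF //.
(* The points violating the bound lie in [N], so [M] belongs to the set whose infimum is the
   essential supremum. *)
have esssup_le (M : R) : (forall x, eball x0 (beta * r) x -> ~ N x -> enorm (u x) <= M) ->
    (esssup (eball x0 (beta * r)) (fun x => enorm (u x)) <= M%:E)%E.
  move=> uM; apply: ereal_inf_lbound; exists N; split => //; split => // x [xB].
  by rewrite lte_fin => xM; apply: contrapT => Nx; have := uM _ xB Nx; rewrite leNgt xM.
have -> : n%:R + p - 1 = n%:R + q by rewrite /q addrA.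
split => [mC|mC]; apply: esssup_le => x xB Nx.
  exact: (optimal_step _ (s beta)) (bound x xB Nx) mC.
exact: (maximal_step _ (s beta)) (bound x xB Nx) mC.
Qed.
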